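(* Let $\mathcal{R}$ be a unital commutative ring and $\mathcal{B}\subset\mathcal{A}$ an inclusion of unital $\mathcal{R}$-algebras (with common unit). Let $\pi=\begin{bmatrix} \ast & b \\ \ast & a \end{bmatrix}/\sim^{(1;2)}_{1}\in Gr_{1}(\mathcal{A})$ with $a,b\in\mathcal{A}$, let $b'\in\mathcal{A}$ be an element such that $b'b=1$, and let $f$ be an nc function from an admissible nc set $\Omega$ over $Gr(\mathcal{B})$ to $M(\mathcal{A})$. Assume that for any $n\in\mathbb{Z}_{\geq1}$ and any $\beta\in\Omega\cap M_{n}(\mathcal{B})$ there exists an element $c(\beta)\in GL_{n}(\mathcal{A})$ such that $f(\widetilde{\beta})=(b\otimes I_{n})c(\beta)$. If $f$ satisfies $$(\widetilde{\Delta}f)(\sigma;\sigma')(X)=-f(\sigma)Xf(\sigma')\quad\text{for any } n,n'\in\mathbb{Z}_{\geq1},\ \sigma\in\Omega_n,\ \sigma'\in\Omega_{n'},\ X\in M_{n,n'}(\mathcal{B}),$$ and $$f(\widetilde{\beta_{0}})=b\cdot(\beta_{0}b-a)^{-1}\quad\text{for some }\beta_{0}\in\Omega\cap\mathcal{B}$$ (where $\beta_0b-a$ is understood to be invertible in $\mathcal{A}$), then $\Omega\cap M(\mathcal{B})\subset\widetilde{\rho}(\pi;\mathcal{B})\cap M(\mathcal{B})$ and $f=\widetilde{\mathfrak{R}}(\pi;\mathcal{B})$ on $\Omega\cap M(\mathcal{B})$.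
   Context: Notation: scalars in $\mathcal{R}$ act centrally on algebras. For an $\mathcal{R}$-module $\mathcal{M}$, $M_{n,n'}(\mathcal{M})$ denotes $n\times n'$ matrices over $\mathcal{M}$, $M_n(\mathcal{M})=M_{n,n}(\mathcal{M})$, $M(\mathcal{M})=\bigsqcup_{n\geq1}M_n(\mathcal{M})$; $GL_n(\mathcal{A})$ is the group of invertible elements of $M_n(\mathcal{A})$; for $b\in\mathcal{A}$, $b\otimes I_n\in M_n(\mathcal{A})$ is the diagonal matrix with all diagonal entries $b$. The nc Grassmannian for $(d;m)=(1;2)$: for a unital $\mathcal{R}$-algebra $\mathcal{C}$ and $A,B\in GL_2(M_n(\mathcal{C}))$, write $A\sim_nB$ (also $\sim^{(1;2)}_n$) iff $A=B\begin{bmatrix} x & 0 \\ y & z \end{bmatrix}$ with $x,z\in GL_1(M_n(\mathcal{C}))=GL_n(\mathcal{C})$, $y\in M_n(\mathcal{C})$. Put $Gr_n(\mathcal{C})=GL_2(M_n(\mathcal{C}))/\sim_n$, $Gr(\mathcal{C})=\bigsqcup_nGr_n(\mathcal{C})$. The notation $\begin{bmatrix} \ast & b \\ \ast & a \end{bmatrix}/\sim^{(1;2)}_1$ means the class of some invertible matrix with second column $(b,a)^{T}$. Operations (well defined): for block matrices $A=[A_{i,j}]\in M_2(M_n(\mathcal{C}))$, $A'=[A'_{i,j}]\in M_2(M_{n'}(\mathcal{C}))$, $A\widetilde{\oplus}A'\in M_2(M_{n+n'}(\mathcal{C}))$ has $(i,j)$ block $A_{i,j}\oplus A'_{i,j}$;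 $\sigma\oplus\sigma'$ is the class of $A\widetilde{\oplus}A'$, $A\in\sigma$, $A'\in\sigma'$; for $s\in GL_n(\mathcal{R})$, $s\cdot\sigma$ is the class of $(s\oplus s)A$, $A\in\sigma$. Affine points: for $\beta\in M_n(\mathcal{B})$, $\widetilde{\beta}=\begin{bmatrix} 0 & I_n \\ I_n & \beta \end{bmatrix}/\sim_n\in Gr_n(\mathcal{B})$. The map $\beta\mapsto\widetilde{\beta}$ is injective and one identifies: for $\Omega\subset Gr(\mathcal{B})$, $\Omega\cap M_n(\mathcal{B})$ denotes $\{\beta\in M_n(\mathcal{B}):\widetilde{\beta}\in\Omega\}$ and $\Omega\cap M(\mathcal{B})=\bigsqcup_n(\Omega\cap M_n(\mathcal{B}))$, $\Omega\cap\mathcal{B}=\Omega\cap M_1(\mathcal{B})$; a function on $\Omega$ is evaluated at $\beta$ as its value at $\widetilde{\beta}$. nc sets and functions: an nc set over $Gr(\mathcal{B})$ is $\Omega=\bigsqcup_n\Omega_n$ with $\Omega_n\subset Gr_n(\mathcal{B})$ and $\Omega_n\oplus\Omega_{n'}\subset\Omega_{n+n'}$. A function $f:\Omega\to M(\mathcal{A})$ is nc if $f(\Omega_n)\subset M_n(\mathcal{A})$, $f(\sigma\oplus\sigma')=f(\sigma)\oplus f(\sigma')$, and $f(s\cdot\sigma)=sf(\sigma)s^{-1}$ whenever $\sigma\in\Omega_n$, $s\in GL_n(\mathcal{R})$, $s\cdot\sigma\in\Omega_n$. Difference-differential operator: for $\sigma\in Gr_n(\mathcal{B})$, $\sigma'\in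 Gr_{n'}(\mathcal{B})$, $X\in M_{n,n'}(\mathcal{B})$, let $(\sigma;\sigma')(X)\in Gr_{n+n'}(\mathcal{B})$ be the class (independent of $A\in\sigma$, $A'\in\sigma'$) of the matrix obtained from $A\widetilde{\oplus}A'$ by adding $\begin{bmatrix} 0_n & XA'_{1,2} \\ 0 & 0_{n'} \end{bmatrix}$ to its $(2,2)$ block. $\Omega$ is admissible if for all $\sigma\in\Omega_n$, $\sigma'\in\Omega_{n'}$, $X\in M_{n,n'}(\mathcal{B})$ there is an invertible $r\in\mathcal{R}$ with $(\sigma;\sigma')(rX)\in\Omega_{n+n'}$. For an nc function $f$ on such $\Omega$, $f((\sigma;\sigma')(rX))=\begin{bmatrix} f(\sigma) & H \\ 0 & f(\sigma') \end{bmatrix}$ for a unique $H$, and $(\widetilde{\Delta}f)(\sigma;\sigma')(X):=r^{-1}H$, independent of the choice of $r$. Resolvent: for $\pi\in Gr_1(\mathcal{A})$ with representative having second column $(b,a)^{T}$, $\widetilde{\rho}(\pi;\mathcal{B})=\bigsqcup_n\widetilde{\rho}_n(\pi;\mathcal{B})$, where $\widetilde{\rho}_n(\pi;\mathcal{B})$ is the set of $\sigma\in Gr_n(\mathcal{B})$ such that, for some (equivalently all) $B=[B_{i,j}]\in\sigma$, the matrix $r=\begin{bmatrix} b\otimes I_n & B_{1,2} \\ a\otimes I_n & B_{2,2} \end{bmatrix}$ is invertible in $M_2(M_n(\mathcal{A}))$. The resolvent $\widetilde{\mathfrak{R}}(\pi;\mathcal{B}):\widetilde{\rho}(\pi;\mathcal{B})\to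 M(\mathcal{A})$ is $\widetilde{\mathfrak{R}}(\pi;\mathcal{B})(\sigma)=B_{1,2}\,\zeta$, where $\zeta\in M_n(\mathcal{A})$ is the $(2,2)$ block of $r^{-1}$; these are independent of the choices of representatives. *)

(* Defs.v *)
From HB Require Import structures.
From mathcomp Require Import all_boot all_order all_algebra.
From mathcomp Require Import boolp classical_sets.

Set Implicit Arguments.
Unset Strict Implicit.
Unset Printing Implicit Defensive.

Import GRing.Theory.
Local Open Scope classical_set_scope.
Local Open Scope ring_scope.
Local Open Scope quotient_scope.

(* Invertibility in a possibly noncommutative ring with no computable inverse
   (so neither unitRingType nor unitmx applies); used at [S := 'M[C]_n] too. *)
Definition inverse_of (S : pzRingType) (x y : S) : Prop :=
  x * y = 1 /\ y * x = 1.

Definition invertible (S : pzRingType) (x : S) : Prop :=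
  exists y, inverse_of x y.

(* The two-sided inverse of x; equal to 0 when x is not invertible. *)
Definition inverse (S : pzRingType) (x : S) : S :=
  xget 0 [set y | inverse_of x y].

Lemma inverse_of_uniq (S : pzRingType) (x y y' : S) :
  inverse_of x y -> inverse_of x y' -> y = y'.
Proof. by move=> [_ yx] [xy' _]; rewrite -[y]mulr1 -xy' mulrA yx mul1r. Qed.

Lemma inverseE (S : pzRingType) (x y : S) : inverse_of x y -> inverse x = y.
Proof.
move=> xy; rewrite /inverse; case: xgetP => [z _ xz|/(_ y)] //.
exact: (inverse_of_uniq xz xy).
Qed.

Lemma inverseP (S : pzRingType) (x : S) :
  invertible x -> inverse_of x (inverse x).
Proof. by move=> [y xy]; rewrite (inverseE xy). Qed.

Lemma invertible1 (S : pzRingType) : invertible (1 : S).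
Proof. by exists 1; rewrite /inverse_of mulr1. Qed.

Lemma invertibleM (S : pzRingType) (x y : S) :
  invertible x -> invertible y -> invertible (x * y).
Proof.
move=> [x' [xx' x'x]] [y' [yy' y'y]]; exists (y' * x'); split.
  by rewrite mulrA -(mulrA x) yy' mulr1.
by rewrite mulrA -(mulrA y') x'x mulr1.
Qed.

Lemma invertible_inverse (S : pzRingType) (x : S) :
  invertible x -> invertible (inverse x).
Proof. by move=> /inverseP[xy yx]; exists x. Qed.

Definition GL (C : pzRingType) (n : nat) :=
  {A : 'M[C]_n | `[< invertible A >]}.

Lemma GLP (C : pzRingType) n (A : GL C n) : invertible (\val A).
Proof. by apply/asboolP; apply: (valP A). Qed.

Definition toGL (C : pzRingType) n (A : 'M[C]_n) (iA : invertible A) : GL C n :=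
  exist (fun M => is_true `[< invertible M >]) A (asboolT iA).

(* GL_2(M_n(C)) is GL C (n + n): the (i,j) blocks (i, j = 1, 2) of A are
   ulsubmx A, ursubmx A, dlsubmx A, drsubmx A. *)

Section Grassmannian.
Variables (C : pzRingType) (n : nat).
Implicit Types A B D : GL C (n + n).

Lemma invertible_ltriang (x z y : 'M[C]_n) :
  invertible x -> invertible z -> invertible (block_mx x 0 y z).
Proof.
move=> [x' [xx' x'x]] [z' [zz' z'z]].
rewrite -!mulmxE in xx' x'x zz' z'z.
exists (block_mx x' 0 (- (z' *m y *m x')) z').
rewrite /inverse_of -!mulmxE !mulmx_block !mulmx0 !mul0mx !addr0 !add0r.
rewrite xx' x'x zz' z'z mulmxN !mulmxA zz' mul1mx subrr mulNmx.
by rewrite -(mulmxA _ x') x'x mulmx1 addNr -!scalar_mx_block.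
Qed.

Definition gr_sim : rel (GL C (n + n)) := fun A B =>
  `[< exists x z : GL C n, exists y : 'M[C]_n,
        \val A = \val B *m block_mx (\val x) 0 y (\val z) >].

Lemma gr_sim_refl : reflexive gr_sim.
Proof.
move=> A; apply/asboolP.
exists (toGL (invertible1 _)), (toGL (invertible1 _)), 0 => /=.
by rewrite -scalar_mx_block mulmx1.
Qed.

Lemma gr_sim_trans : transitive gr_sim.
Proof.
move=> B A D /asboolP[x [z [y AB]]] /asboolP[x' [z' [y' BD]]]; apply/asboolP.
exists (toGL (invertibleM (GLP x') (GLP x))).
exists (toGL (invertibleM (GLP z') (GLP z))).
exists (y' *m \val x + \val z' *m y) => /=.
by rewrite AB BD -mulmxA mulmx_block !mulmx0 !mul0mx !addr0 !add0r.
Qed.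

Lemma gr_sim_sym : symmetric gr_sim.
Proof.
suff H A B : gr_sim A B -> gr_sim B A by move=> A B; apply/idP/idP; apply: H.
move=> /asboolP[x [z [y AB]]]; apply/asboolP.
have [xx' x'x] := inverseP (GLP x); have [zz' z'z] := inverseP (GLP z).
rewrite -!mulmxE in xx' x'x zz' z'z.
exists (toGL (invertible_inverse (GLP x))).
exists (toGL (invertible_inverse (GLP z))).
exists (- (inverse (\val z) *m y *m inverse (\val x))) => /=.
rewrite AB -mulmxA mulmx_block !mulmx0 !mul0mx !addr0 !add0r xx' zz'.
by rewrite mulmxN !mulmxA zz' mul1mx subrr -scalar_mx_block mulmx1.
Qed.

Canonical gr_sim_equiv := EquivRel gr_sim gr_sim_refl gr_sim_sym gr_sim_trans.

Definition Gr := {eq_quot gr_sim}.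

Definition gr_class (A : GL C (n + n)) : Gr := \pi A.

Lemma gr_classP A B : gr_class A = gr_class B <->
  exists x z : GL C n, exists y : 'M[C]_n,
    \val A = \val B *m block_mx (\val x) 0 y (\val z).
Proof.
split=> [/eqP|H]; rewrite /gr_class; first by rewrite eqmodE => /asboolP.
by apply/eqP; rewrite eqmodE; apply/asboolP.
Qed.

Lemma invertible_affine (beta : 'M[C]_n) :
  invertible (block_mx 0 1%:M 1%:M beta).
Proof.
exists (block_mx (- beta) 1%:M 1%:M 0).
rewrite /inverse_of -!mulmxE !mulmx_block !mulmx0 !mul0mx !mulmx1 !mul1mx.
by rewrite !addr0 !add0r !addNr -!scalar_mx_block.
Qed.

Definition affine (beta : 'M[C]_n) : Gr :=
  gr_class (toGL (invertible_affine beta)).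

End Grassmannian.

(* Omega \cap M_n(C), under the identification of beta with affine beta *)
Definition affine_part (C : pzRingType) (Omega : forall n, set (Gr C n)) n :
  set 'M[C]_n := @affine C n @^-1` Omega n.

Definition dsum_mx (C : pzRingType) n n' (A : 'M[C]_n) (A' : 'M[C]_n') :
  'M[C]_(n + n') := block_mx A 0 0 A'.

Definition bsum_mx (C : pzRingType) n n'
    (A : 'M[C]_(n + n)) (A' : 'M[C]_(n' + n')) :
    'M[C]_((n + n') + (n + n')) :=
  block_mx (dsum_mx (ulsubmx A) (ulsubmx A')) (dsum_mx (ursubmx A) (ursubmx A'))
           (dsum_mx (dlsubmx A) (dlsubmx A')) (dsum_mx (drsubmx A) (drsubmx A')).

Section Operations.
Variables (C : pzRingType) (n n' : nat).

(* Blockwise assembly of the 2 x 2 block matrix whose (i,j) block is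
   [A_ij, Y_ij; 0, A'_ij]. *)
Let btri_mx (A : 'M[C]_(n + n)) (Y : 'M[C]_(n + n, n' + n'))
    (A' : 'M[C]_(n' + n')) : 'M[C]_((n + n') + (n + n')) :=
  block_mx
    (block_mx (ulsubmx A) (ulsubmx Y) 0 (ulsubmx A'))
    (block_mx (ursubmx A) (ursubmx Y) 0 (ursubmx A'))
    (block_mx (dlsubmx A) (dlsubmx Y) 0 (dlsubmx A'))
    (block_mx (drsubmx A) (drsubmx Y) 0 (drsubmx A')).

Let btri_mxM A Y A' B Z B' :
  btri_mx A Y A' *m btri_mx B Z B' =
  btri_mx (A *m B) (A *m Z + Y *m B') (A' *m B').
Proof.
rewrite -[A]submxK -[Y]submxK -[A']submxK -[B]submxK -[Z]submxK -[B']submxK.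
rewrite /btri_mx !(mulmx_block, add_block_mx).
rewrite !block_mxKul !block_mxKur !block_mxKdl !block_mxKdr.
rewrite !(mul0mx, mulmx0, addr0, add0r).
by congr block_mx; congr block_mx; rewrite addrACA.
Qed.

Let btri_mx1 : btri_mx 1%:M 0 1%:M = 1%:M.
Proof.
rewrite /btri_mx (scalar_mx_block n n) (scalar_mx_block n' n').
rewrite !block_mxKul !block_mxKur !block_mxKdl !block_mxKdr.
rewrite /ulsubmx /ursubmx /dlsubmx /drsubmx !linear0.
by rewrite !block_mx0 -!scalar_mx_block.
Qed.

Let invertible_btri A Y A' :
  invertible A -> invertible A' -> invertible (btri_mx A Y A').
Proof.
move=> [B [AB BA]] [B' [AB' BA']]; rewrite -!mulmxE in AB BA AB' BA'.
exists (btri_mx B (- (B *m Y *m B')) B').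
rewrite /inverse_of -!mulmxE !btri_mxM AB BA AB' BA' mulmxN mulNmx !mulmxA AB.
by rewrite mul1mx addNr -(mulmxA _ B') BA' mulmx1 subrr btri_mx1.
Qed.

Let invertible_utri (x : 'M[C]_n) (w : 'M[C]_(n, n')) (x' : 'M[C]_n') :
  invertible x -> invertible x' -> invertible (block_mx x w 0 x').
Proof.
move=> [z [xz zx]] [z' [xz' zx']]; rewrite -!mulmxE in xz zx xz' zx'.
exists (block_mx z (- (z *m w *m z')) 0 z').
rewrite /inverse_of -!mulmxE !mulmx_block !mulmx0 !mul0mx !addr0 !add0r.
rewrite xz zx xz' zx' mulmxN mulNmx !mulmxA xz mul1mx addNr.
by rewrite -(mulmxA _ z') zx' mulmx1 subrr -!scalar_mx_block.
Qed.

Let btri_ltriang x y z (w1 w2 : 'M[C]_(n, n')) x' y' z' :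
  btri_mx (block_mx x 0 y z) (block_mx w1 0 w2 0) (block_mx x' 0 y' z') =
  block_mx (block_mx x w1 0 x') 0 (block_mx y w2 0 y') (block_mx z 0 0 z').
Proof.
rewrite /btri_mx !block_mxKul !block_mxKur !block_mxKdl !block_mxKdr.
by rewrite !block_mx0.
Qed.

Let btri_bsum A A' : btri_mx A 0 A' = bsum_mx A A'.
Proof. by rewrite /btri_mx /ulsubmx /ursubmx /dlsubmx /drsubmx !linear0. Qed.

Let btri_dd A A' X :
  btri_mx A (block_mx 0 0 0 (X *m ursubmx A')) A' =
  bsum_mx A A' + block_mx 0 0 0 (block_mx 0 (X *m ursubmx A') 0 0).
Proof.
rewrite /btri_mx /bsum_mx /dsum_mx !block_mxKul !block_mxKur !block_mxKdl.
by rewrite !block_mxKdr !add_block_mx !addr0 add0r.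
Qed.

Lemma invertible_bsum (A : GL C (n + n)) (A' : GL C (n' + n')) :
  invertible (bsum_mx (\val A) (\val A')).
Proof. by rewrite -btri_bsum; apply: invertible_btri; apply: GLP. Qed.

Definition gr_sum (sigma : Gr C n) (sigma' : Gr C n') : Gr C (n + n') :=
  gr_class (toGL (invertible_bsum (repr sigma) (repr sigma'))).

Definition dd_mx (A : 'M[C]_(n + n)) (A' : 'M[C]_(n' + n'))
    (X : 'M[C]_(n, n')) : 'M[C]_((n + n') + (n + n')) :=
  bsum_mx A A' + block_mx 0 0 0 (block_mx 0 (X *m ursubmx A') 0 0).

Lemma invertible_dd (A : GL C (n + n)) (A' : GL C (n' + n')) X :
  invertible (dd_mx (\val A) (\val A') X).
Proof. by rewrite /dd_mx -btri_dd; apply: invertible_btri; apply: GLP. Qed.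

(* (sigma; sigma')(X) *)
Definition gr_dd (sigma : Gr C n) (sigma' : Gr C n') (X : 'M[C]_(n, n')) :
  Gr C (n + n') := gr_class (toGL (invertible_dd (repr sigma) (repr sigma') X)).

Lemma gr_sum_class (A : GL C (n + n)) (A' : GL C (n' + n')) :
  gr_sum (gr_class A) (gr_class A') =
  gr_class (toGL (invertible_bsum A A')).
Proof.
have /gr_classP[x [z [y AE]]] : gr_class (repr (gr_class A)) = gr_class A.
  exact: reprK.
have /gr_classP[x' [z' [y' AE']]] :
  gr_class (repr (gr_class A')) = gr_class A' by exact: reprK.
apply/gr_classP => /=; rewrite AE AE'.
exists (toGL (invertible_utri 0 (GLP x) (GLP x'))).
exists (toGL (invertible_utri 0 (GLP z) (GLP z'))).
exists (dsum_mx y y') => /=.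
rewrite -btri_ltriang -!btri_bsum btri_mxM.
by rewrite block_mx0 mulmx0 mul0mx addr0.
Qed.

Lemma gr_dd_class (A : GL C (n + n)) (A' : GL C (n' + n')) X :
  gr_dd (gr_class A) (gr_class A') X = gr_class (toGL (invertible_dd A A' X)).
Proof.
have /gr_classP[x [z [y AE]]] : gr_class (repr (gr_class A)) = gr_class A.
  exact: reprK.
have /gr_classP[x' [z' [y' AE']]] :
  gr_class (repr (gr_class A')) = gr_class A' by exact: reprK.
have [D [AD0 _]] := GLP A; have AD : \val A *m D = 1%:M by exact: AD0.
pose V := X *m ursubmx (\val A') *m y'.
pose w1 := - (ursubmx D *m V); pose w2 := - (drsubmx D *m V).
pose V0 : 'M[C]_(n + n, n' + n') := block_mx 0 0 V 0.
have AW : \val A *m block_mx w1 0 w2 0 = - V0.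
  rewrite -[- V0]mul1mx -AD -mulmxA; congr (_ *m _).
  rewrite -[D in RHS]submxK mulmxN mulmx_block !mulmx0 !addr0 !add0r.
  by rewrite opp_block_mx !oppr0.
apply/gr_classP => /=; rewrite AE AE'.
exists (toGL (invertible_utri w1 (GLP x) (GLP x'))).
exists (toGL (invertible_utri 0 (GLP z) (GLP z'))).
exists (block_mx y w2 0 y') => /=.
rewrite -btri_ltriang /dd_mx -!btri_dd btri_mxM AW; congr btri_mx.
rewrite mulmx_block !mul0mx !addr0 -/V -[\val A' in LHS]submxK.
rewrite mulmx_block block_mxKur !mulmx0 !add0r -?mulmxA.
by rewrite opp_block_mx add_block_mx !oppr0 !addr0 !add0r addNr.
Qed.

End Operations.


Section Scalars.
Variables (R : comPzRingType) (C : algType R) (n : nat).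

Definition scal_mx (s : 'M[R]_n) : 'M[C]_n := map_mx (in_alg C) s.

Lemma invertible_scal (s : GL R n) : invertible (scal_mx (\val s)).
Proof.
have [s' [ss' s's]] := GLP s; rewrite -!mulmxE in ss' s's.
by exists (scal_mx s'); rewrite /inverse_of -!mulmxE -!map_mxM ss' s's !map_mx1.
Qed.

Lemma invertible_act (s : GL R n) (A : GL C (n + n)) :
  invertible (dsum_mx (scal_mx (\val s)) (scal_mx (\val s)) *m \val A).
Proof.
apply: invertibleM (GLP A); rewrite /dsum_mx.
by apply: invertible_ltriang; apply: invertible_scal.
Qed.

Definition gr_act (s : GL R n) (sigma : Gr C n) : Gr C n :=
  gr_class (toGL (invertible_act s (repr sigma))).

Lemma gr_act_class (s : GL R n) (A : GL C (n + n)) :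
  gr_act s (gr_class A) = gr_class (toGL (invertible_act s A)).
Proof.
have /gr_classP[x [z [y AE]]] : gr_class (repr (gr_class A)) = gr_class A.
  exact: reprK.
apply/gr_classP => /=; exists x, z, y; rewrite AE; exact: mulmxA.
Qed.

End Scalars.

Section NCFunctions.
Variables (R : comPzRingType) (B A : algType R).

(* Graded sets and functions are indexed by all n : nat, but every condition
   below constrains only the components with 0 < n. Since 'M[B]_(n, n') is a
   module over B, the product r X with r : R is written r%:A *: X. *)
Variable Omega : forall n, set (Gr B n).
(* Only the values of f on Omega matter. *)
Variable f : forall n, Gr B n -> 'M[A]_n.

Definition nc_set : Prop :=
  forall n n' (sigma : Gr B n) (sigma' : Gr B n'), (0 < n)%N -> (0 < n')%N ->
    Omega sigma -> Omega sigma' -> Omega (gr_sum sigma sigma').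

Definition admissible : Prop :=
  forall n n' (sigma : Gr B n) (sigma' : Gr B n') (X : 'M[B]_(n, n')),
    (0 < n)%N -> (0 < n')%N -> Omega sigma -> Omega sigma' ->
    exists2 r : R, invertible r & Omega (gr_dd sigma sigma' (r%:A *: X)).

Definition nc_function : Prop :=
  (forall n n' (sigma : Gr B n) (sigma' : Gr B n'), (0 < n)%N -> (0 < n')%N ->
     Omega sigma -> Omega sigma' ->
     f (gr_sum sigma sigma') = dsum_mx (f sigma) (f sigma')) /\
  (forall n (s : GL R n) (sigma : Gr B n), (0 < n)%N ->
     Omega sigma -> Omega (gr_act s sigma) ->
     f (gr_act s sigma) =
       scal_mx A (\val s) *m f sigma *m scal_mx A (inverse (\val s))).

(* The operator Delta~ : r is a chosen admissible scalar, and the block H of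
   f((sigma; sigma')(r X)) is its upper right block. *)
Definition nc_delta n n' (sigma : Gr B n) (sigma' : Gr B n')
    (X : 'M[B]_(n, n')) : 'M[A]_(n, n') :=
  let r := xget 1 [set r : R | invertible r /\
                     Omega (gr_dd sigma sigma' (r%:A *: X))] in
  (inverse r)%:A *: ursubmx (f (gr_dd sigma sigma' (r%:A *: X))).

End NCFunctions.

Section Resolvent.
Variables (R : comPzRingType) (B A : algType R) (incl : {lrmorphism B -> A}).

Definition gr_second_col (b a : A) (pi : Gr A 1) : Prop :=
  exists P : GL A (1 + 1),
    [/\ gr_class P = pi, ursubmx (\val P) = b%:M & drsubmx (\val P) = a%:M].

Definition resolvent_mx n (P : 'M[A]_(1 + 1)) (M : 'M[B]_(n + n)) :
    'M[A]_(n + n) :=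
  block_mx (ursubmx P ord0 ord0)%:M (map_mx incl (ursubmx M))
           (drsubmx P ord0 ord0)%:M (map_mx incl (drsubmx M)).

Definition resolvent_val n (P : 'M[A]_(1 + 1)) (M : 'M[B]_(n + n)) : 'M[A]_n :=
  map_mx incl (ursubmx M) *m drsubmx (inverse (resolvent_mx P M)).

Definition resolvent_set (pi : Gr A 1) n : set (Gr B n) :=
  [set sigma | invertible (resolvent_mx (\val (repr pi)) (\val (repr sigma)))].

Definition resolvent (pi : Gr A 1) n (sigma : Gr B n) : 'M[A]_n :=
  resolvent_val (\val (repr pi)) (\val (repr sigma)).

Let resolvent_mx_sim n (P Q : GL A (1 + 1)) (M N : GL B (n + n)) :
  gr_class P = gr_class Q -> gr_class M = gr_class N ->
  exists p q : 'M[A]_n, [/\ invertible p, invertible q,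
    map_mx incl (ursubmx (\val M)) = map_mx incl (ursubmx (\val N)) *m q &
    resolvent_mx (\val P) (\val M) =
      resolvent_mx (\val Q) (\val N) *m block_mx p 0 0 q].
Proof.
move=> /gr_classP[x [z [y PE]]] /gr_classP[u [w [v ME]]].
have urE k (C : pzRingType) (T : 'M[C]_(k + k)) a b c :
    (ursubmx (T *m block_mx a 0 b c) = ursubmx T *m c) *
    (drsubmx (T *m block_mx a 0 b c) = drsubmx T *m c).
  rewrite -[T]submxK mulmx_block !mulmx0 !add0r.
  by rewrite !block_mxKur !block_mxKdr.
exists ((\val z) ord0 ord0)%:M, (map_mx incl (\val w)).
have [z' [zz' z'z]] := GLP z; have [w' [ww' w'w]] := GLP w.
rewrite -!mulmxE in zz' z'z ww' w'w.
have e11 (g h : 'M[A]_1) : (g *m h) ord0 ord0 = g ord0 ord0 * h ord0 ord0.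
  by rewrite mxE big_ord1.
split.
- exists (z' ord0 ord0)%:M; rewrite /inverse_of -!mulmxE -!scalar_mxM -!e11.
  by rewrite zz' z'z mxE.
- exists (map_mx incl w'); rewrite /inverse_of -!mulmxE -!map_mxM ww' w'w.
  by rewrite map_mx1.
- by rewrite ME urE map_mxM.
rewrite /resolvent_mx PE ME !urE !map_mxM !e11 mulmx_block !mulmx0.
by rewrite !addr0 !add0r !scalar_mxM.
Qed.

Lemma resolvent_set_class n (P : GL A (1 + 1)) (M : GL B (n + n)) :
  resolvent_set (gr_class P) (gr_class M) <->
  invertible (resolvent_mx (\val P) (\val M)).
Proof.
have H P0 P1 (M0 M1 : GL B (n + n)) :
    gr_class P0 = gr_class P1 -> gr_class M0 = gr_class M1 ->
    invertible (resolvent_mx (\val P1) (\val M1)) ->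
    invertible (resolvent_mx (\val P0) (\val M0)).
  move=> eP eM iPM; have [p [q [ip iq _ ->]]] := resolvent_mx_sim eP eM.
  by apply: invertibleM iPM _; apply: invertible_ltriang.
by split; apply: H; rewrite /gr_class reprK.
Qed.

Lemma resolvent_class n (P : GL A (1 + 1)) (M : GL B (n + n)) :
  invertible (resolvent_mx (\val P) (\val M)) ->
  resolvent (gr_class P) (gr_class M) = resolvent_val (\val P) (\val M).
Proof.
move=> iPM; rewrite /resolvent /resolvent_val.
have [||p [q [[p' [pp' p'p]] [q' [qq' q'q]] -> ->]]] :=
  @resolvent_mx_sim n (repr (gr_class P)) P (repr (gr_class M)) M.
- exact: reprK.
- exact: reprK.
rewrite -!mulmxE in pp' p'p qq' q'q.
have [rr' r'r] := inverseP iPM; rewrite -!mulmxE in rr' r'r.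
set r' := inverse _ in rr' r'r *.
rewrite (@inverseE _ _ (block_mx p' 0 0 q' *m r')); last first.
  have e1 : block_mx p 0 0 q *m block_mx p' 0 0 q' = 1%:M.
    rewrite mulmx_block !mulmx0 !mul0mx !addr0 !add0r pp' qq'.
    by rewrite -scalar_mx_block.
  have e2 : block_mx p' 0 0 q' *m block_mx p 0 0 q = 1%:M.
    rewrite mulmx_block !mulmx0 !mul0mx !addr0 !add0r p'p q'q.
    by rewrite -scalar_mx_block.
  rewrite /inverse_of -!mulmxE; split.
    by rewrite mulmxA -(mulmxA _ (block_mx p 0 0 q)) e1 mulmx1.
  by rewrite mulmxA -(mulmxA _ r') r'r mulmx1.
rewrite -[r' in LHS]submxK mulmx_block !mul0mx !add0r block_mxKdr.
by rewrite -mulmxA (mulmxA q) qq' mul1mx.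
Qed.

End Resolvent.

(* Main.v *)
(* Equivariance of f under unipotent similarities turns the differential
   equation, at beta and beta0 and along X = Y beta0 - beta Y with Y a column
   over R, into Y f(beta0) - f(beta) Y = - f(beta) (Y beta0 - beta Y) f(beta0).
   Letting Y run over the standard basis and cancelling beta0 b - a yields
   f(beta) (beta b - a) = b. Since f(beta) = b c with c invertible and b is left
   cancellable, c = (beta b - a)^-1, and block elimination shows that the
   resolvent matrix [b, 1; a, beta] is invertible, with (2,2) block of its
   inverse equal to b (beta b - a)^-1 = f(beta). *)

Require Import Defs.
From HB Require Import structures.
From mathcomp Require Import all_boot all_order all_algebra.
From mathcomp Require Import boolp classical_sets.

Set Implicit Arguments.
Unset Strict Implicit.
Unset Printing Implicit Defensive.

Import GRing.Theory.
Local Open Scope classical_set_scope.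
Local Open Scope ring_scope.

Section ScalarMatrices.
Variables (R : comPzRingType) (C : algType R).

Lemma map_in_alg_scale m n (r : R) (Y : 'M[R]_(m, n)) :
  map_mx (in_alg C) (r *: Y) = r%:A *: map_mx (in_alg C) Y.
Proof. by apply/matrixP=> i j; rewrite !mxE /= mulr_algl scalerA. Qed.

Lemma mulmx_scale_alg m n p (r : R) (M : 'M[C]_(m, n)) (N : 'M[C]_(n, p)) :
  M *m (r%:A *: N) = r%:A *: (M *m N).
Proof.
apply/matrixP=> i j; rewrite !mxE mulr_sumr; apply: eq_bigr => k _.
by rewrite mxE !mulr_algl scalerAr.
Qed.

Lemma scale_algVK m n (r r' : R) (M : 'M[C]_(m, n)) :
  r * r' = 1 -> r%:A *: (r'%:A *: M) = M.
Proof. by move=> rr'; rewrite scalerA mulr_algl scalerA rr' !scale1r. Qed.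

(** The entries come from [R], which acts centrally; [x%:M] has size 1 on the left-hand side and
    size n on the right-hand side. *)
Lemma map_in_alg_delta_scalar n (i : 'I_n) (x : C) :
  map_mx (in_alg C) (delta_mx i (ord0 : 'I_1)) *m x%:M =
  x%:M *m map_mx (in_alg C) (delta_mx i (ord0 : 'I_1)).
Proof.
apply/matrixP=> k j; rewrite mul_scalar_mx !mxE big_ord1 !mxE (ord1 j) /=.
by rewrite mulr1n mulr_algl mulr_algr.
Qed.

End ScalarMatrices.

Section AffinePoints.
Variables (R : comPzRingType) (C : algType R).

Lemma gr_sum_affine n n' (x : 'M[C]_n) (x' : 'M[C]_n') :
  gr_sum (affine x) (affine x') = affine (dsum_mx x x').
Proof.
rewrite gr_sum_class /affine; congr gr_class; apply: val_inj => /=.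
rewrite /bsum_mx !block_mxKul !block_mxKur !block_mxKdl !block_mxKdr /dsum_mx.
by rewrite !block_mx0 -!scalar_mx_block.
Qed.

(** The (1,2) block of an affine representative is the identity, so [X] enters the corner
    unchanged. *)
Lemma gr_dd_affine n n' (x : 'M[C]_n) (x' : 'M[C]_n') X :
  gr_dd (affine x) (affine x') X = affine (block_mx x X 0 x').
Proof.
rewrite gr_dd_class /affine; congr gr_class; apply: val_inj => /=.
rewrite /dd_mx /bsum_mx !block_mxKul !block_mxKur !block_mxKdl !block_mxKdr.
rewrite /dsum_mx !block_mx0 -!scalar_mx_block !add_block_mx !addr0 !add0r.
by rewrite mulmx1.
Qed.

(** The action turns [0, 1; 1, x] into [0, s; s, s x] = [0, 1; 1, s x s^-1] diag(s, s), and the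
    class ignores the right factor. *)
Lemma gr_act_affine n (s : GL R n) (x : 'M[C]_n) :
  gr_act s (affine x) =
  affine (scal_mx C (\val s) *m x *m scal_mx C (inverse (\val s))).
Proof.
rewrite gr_act_class; apply/gr_classP => /=.
have [ss' s's] := inverseP (GLP s); rewrite -!mulmxE in ss' s's.
exists (toGL (invertible_scal C s)), (toGL (invertible_scal C s)), 0 => /=.
have s'sC : scal_mx C (inverse (\val s)) *m scal_mx C (\val s) = 1%:M.
  by rewrite /scal_mx -map_mxM s's map_mx1.
rewrite /dsum_mx !mulmx_block !(mul0mx, mulmx0, addr0, add0r) !(mulmx1, mul1mx).
by rewrite -(mulmxA _ _ (scal_mx C (\val s))) s'sC mulmx1.
Qed.

End AffinePoints.

Lemma utri1_inverse (R : comPzRingType) n n' (Y : 'M[R]_(n, n')) :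
  inverse_of (block_mx 1%:M Y 0 1%:M : 'M[R]_(n + n'))
             (block_mx 1%:M (- Y) 0 1%:M).
Proof.
rewrite /inverse_of -!mulmxE !mulmx_block !(mul0mx, mulmx0, addr0, add0r).
by rewrite !(mulmx1, mul1mx) addNr subrr -!scalar_mx_block.
Qed.

(* Conjugating [beta (+) beta'] by the unipotent matrix [1, Y; 0, 1] gives
   [beta, Y beta' - beta Y; 0, beta'], where f is known by equivariance. *)
Lemma nc_delta_affine (R : comPzRingType) (B A : algType R)
    (Omega : forall n, set (Gr B n)) (f : forall n, Gr B n -> 'M[A]_n)
    n n' (x : 'M[B]_n) (x' : 'M[B]_n') (Y : 'M[R]_(n, n')) :
  nc_set Omega -> admissible Omega -> nc_function Omega f ->
  (0 < n)%N -> (0 < n')%N -> affine_part Omega x -> affine_part Omega x' ->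
  nc_delta Omega f (affine x) (affine x')
    (map_mx (in_alg B) Y *m x' - x *m map_mx (in_alg B) Y) =
  map_mx (in_alg A) Y *m f n' (affine x') - f n (affine x) *m map_mx (in_alg A) Y.
Proof.
move=> Onc Oadm [fsum fact] n0 n'0 Ox Ox'.
rewrite /nc_delta; set X := _ - _.
(* Admissibility rules out the default value of [xget]. *)
case: xgetP => [r _ [ir Or]|no]; last first.
  by have [r ir Or] := Oadm _ _ _ _ X n0 n'0 Ox Ox'; case: (no r).
have [rr' r'r] := inverseP ir.
(* The corner to be produced is r X, hence r Y in place of Y; the factor r^-1 in [nc_delta] removes
   r at the end. *)
have sI := utri1_inverse (r *: Y).
pose s := toGL (ex_intro _ _ sI).
have scalE (C : algType R) (Z : 'M[R]_(n, n')) :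
    scal_mx C (block_mx 1%:M Z 0 1%:M) =
    block_mx 1%:M (map_mx (in_alg C) Z) 0 1%:M.
  by rewrite /scal_mx map_block_mx !map_mx1 map_mx0.
have ddE : gr_dd (affine x) (affine x') (r%:A *: X) =
           gr_act s (gr_sum (affine x) (affine x')).
  rewrite gr_sum_affine gr_act_affine gr_dd_affine; congr affine => /=.
  rewrite (inverseE sI) !scalE /dsum_mx map_mxN map_in_alg_scale !mulmx_block.
  rewrite !(mul0mx, mulmx0, addr0, add0r, mulmx1, mul1mx).
  by rewrite mulmxN mulmx_scale_alg -scalemxAl addrC -scalerBr.
rewrite ddE in Or *.
have n2 : (0 < n + n')%N by rewrite addn_gt0 n0.
rewrite (fact _ _ _ n2 (Onc _ _ _ _ n0 n'0 Ox Ox') Or) (fsum _ _ _ _ n0 n'0 Ox Ox').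
rewrite /= (inverseE sI) !scalE /dsum_mx map_mxN map_in_alg_scale !mulmx_block.
rewrite !(mul0mx, mulmx0, addr0, add0r, mulmx1, mul1mx) block_mxKur.
rewrite mulmxN mulmx_scale_alg -scalemxAl addrC -scalerBr.
exact: scale_algVK.
Qed.

(** Eliminating with the identity block as pivot, so that [b] need not be invertible, turns the
    second row into (a - x b, 0), whose first entry has inverse -c. *)
Lemma inverse_of_resolvent_block (S : pzRingType) n (x b a c : 'M[S]_n) :
  inverse_of (x *m b - a) c ->
  inverse_of (block_mx b 1%:M a x)
    (block_mx (c *m x) (- c) (1%:M - b *m c *m x) (b *m c)).
Proof.
rewrite /inverse_of -!mulmxE !mulmx_block !(mulmx1, mul1mx) => -[xc cx].
have xbc : x *m b *m c = 1%:M + a *m c by rewrite -[1%:M]xc mulmxBl subrK.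
have cxb : c *m x *m b = 1%:M + c *m a by rewrite -[1%:M]cx mulmxBr mulmxA subrK.
split; rewrite -[RHS]/(1%:M) scalar_mx_block; congr block_mx.
- by rewrite mulmxA addrC subrK.
- by rewrite mulmxN addNr.
- by rewrite mulmxBr mulmx1 !mulmxA xbc mulmxDl mul1mx addrA [X in X - _]addrC subrr.
- by rewrite mulmxN mulmxA xbc addrC addrK.
- by rewrite cxb mulNmx addrK.
- by rewrite mulNmx subrr.
- rewrite mulmxBl mul1mx -!mulmxA (mulmxA c) cxb mulmxDr mulmx1 !mulmxA.
  by rewrite opprD addrA subrr sub0r addNr.
by rewrite subrK.
Qed.

Theorem theorem6p2 (R : comPzRingType) (A B : algType R)
    (incl : {lrmorphism B -> A}) (incl_inj : injective incl)
    (pi : Gr A 1) (a b : A) (pi_ba : gr_second_col b a pi)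
    (b' : A) (b'b : b' * b = 1)
    (Omega : forall n, set (Gr B n))
    (Omega_nc : nc_set Omega) (Omega_adm : admissible Omega)
    (f : forall n, Gr B n -> 'M[A]_n) (f_nc : nc_function Omega f)
    (f_affine : forall n (beta : 'M[B]_n), (0 < n)%N ->
       affine_part Omega beta ->
       exists c : GL A n, f n (affine beta) = b%:M *m \val c)
    (f_delta : forall n n' (sigma : Gr B n) (sigma' : Gr B n')
         (X : 'M[B]_(n, n')),
       (0 < n)%N -> (0 < n')%N -> Omega n sigma -> Omega n' sigma' ->
       nc_delta Omega f sigma sigma' X =
         - (f n sigma *m map_mx incl X *m f n' sigma'))
    (f_init : exists beta0 : B,
       [/\ affine_part Omega (beta0%:M : 'M[B]_1),
           invertible (incl beta0 * b - a) &
           f 1%N (affine (beta0%:M : 'M[B]_1)) =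
             (b * inverse (incl beta0 * b - a))%:M]) :
  (forall n, (0 < n)%N ->
     affine_part Omega (n := n) `<=` affine_part (resolvent_set incl pi) (n := n)) /\
  (forall n (beta : 'M[B]_n), (0 < n)%N -> affine_part Omega beta ->
     f n (affine beta) = resolvent incl pi (affine beta)).
Proof.
have [beta0 [Obeta0 iD fbeta0]] := f_init.
have inclY n (Y : 'M[R]_(n, 1)) :
    map_mx incl (map_mx (in_alg B) Y) = map_mx (in_alg A) Y.
  by apply/matrixP=> i j; rewrite !mxE rmorph_alg.
have key n (beta : 'M[B]_n) : (0 < n)%N -> affine_part Omega beta ->
    f n (affine beta) *m (map_mx incl beta *m b%:M - a%:M) = b%:M.
  move=> n0 Obeta; set F := f _ _.
  have [_ D'D] := inverseP iD; set D := _ - a in iD D'D fbeta0.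
  (* A matrix is determined by its products with the basis columns, which are defined over [R] and
     so may serve as [Y] in [nc_delta_affine]. *)
  suff colP i : (F *m (map_mx incl beta *m b%:M - a%:M)) *m
      map_mx (in_alg A) (delta_mx i (ord0 : 'I_1)) =
      b%:M *m map_mx (in_alg A) (delta_mx i (ord0 : 'I_1)).
    apply/matrixP=> k i; have /matrixP/(_ k ord0) := colP i.
    by rewrite map_delta_mx -!colE !mxE.
  set e := map_mx (in_alg A) _.
  have := f_delta _ _ _ _ (map_mx (in_alg B) (delta_mx i (ord0 : 'I_1)) *m
     beta0%:M - beta *m map_mx (in_alg B) (delta_mx i (ord0 : 'I_1)))
     n0 (ltn0Sn 0) Obeta Obeta0.
  rewrite nc_delta_affine // fbeta0 -/F map_mxB !map_mxM inclY map_scalar_mx -/e.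
  have comm (x : A) : e *m x%:M = x%:M *m e by exact: map_in_alg_delta_scalar.
  (* Right multiplication by D turns f(beta0) = b D^-1 into b. *)
  move=> /(congr1 (mulmx^~ D%:M)).
  rewrite mulmxBl mulNmx -!mulmxA -scalar_mxM -mulrA D'D mulr1.
  move=> /eqP; rewrite subr_eq comm => /eqP ->.
  rewrite [RHS]addrC -mulmxBr; congr (F *m _).
  (* Once [e] is moved to the right, the two terms in beta0 b cancel. *)
  rewrite !mulmxBl -!mulmxA -scalar_mxM !comm /D raddfB /= mulmxBl opprB [RHS]addrC.
  by rewrite addrA addrNK.
have inv n (beta : 'M[B]_n) : (0 < n)%N -> affine_part Omega beta ->
    exists c, inverse_of (map_mx incl beta *m b%:M - a%:M) c /\
              f n (affine beta) = b%:M *m c.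
  move=> n0 Obeta; have [c fE] := f_affine n beta n0 Obeta.
  exists (\val c); split=> //.
  have := key n beta n0 Obeta; rewrite fE => /(congr1 (mulmx b'%:M)).
  rewrite !mulmxA -scalar_mxM b'b mul1mx => cE.
  (* So far beta b - a is only a right inverse of c; invertibility of c makes it the two-sided
     one. *)
  have [c' [cc' c'c]] := GLP c.
  have Ec' : map_mx incl beta *m b%:M - a%:M = c'.
    by rewrite -[LHS]mul1mx -[1%:M]c'c -mulmxE -mulmxA cE mulmx1.
  by rewrite Ec'.
have [P [<- Pb Pa]] := pi_ba.
have res n (beta : 'M[B]_n) : (0 < n)%N -> affine_part Omega beta ->
    exists2 c, f n (affine beta) = b%:M *m c &
      inverse_of (resolvent_mx incl (\val P) (block_mx 0 1%:M 1%:M beta))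
       (block_mx (c *m map_mx incl beta) (- c)
          (1%:M - b%:M *m c *m map_mx incl beta) (b%:M *m c)).
  move=> n0 Obeta; have [c [ic fE]] := inv n beta n0 Obeta; exists c => //.
  rewrite /resolvent_mx Pb Pa block_mxKur block_mxKdr map_mx1 !mxE !mulr1n.
  exact: inverse_of_resolvent_block.
split=> n => [n0 beta Obeta|beta n0 Obeta].
  have [c _ ic] := res n beta n0 Obeta.
  by apply/resolvent_set_class; eexists; exact: ic.
have [c fE ic] := res n beta n0 Obeta.
(* On the affine representative the factor B_{1,2} is 1, so the value is the (2,2) block b c. *)
rewrite resolvent_class; last by eexists; exact: ic.
by rewrite /resolvent_val (inverseE ic) block_mxKur map_mx1 mul1mx block_mxKdr.
Qed.
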